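(* Assume (C1q), (C2q), (C3q) hold (with rates $\sigma_1,\sigma_2,\sigma_3$). Put $Q:=\max\{\sigma_1(b_A-1)-1,0\}$ and let $K\in\mathbb{N}^*$ be such that $$K\ge\max\left\{\|x_Q-p\|,\frac{\|u-Ap\|}{\gamma}\right\}.$$ Suppose $\tau:\mathbb{N}\to\mathbb{N}$ is a monotone function satisfying, for all $k,m\in\mathbb{N}$ and all $x\in\overline{B}_K(p)$: $$\|x-\tilde T_m x\|\le\frac{1}{\tau(k)+1}\quad\text{implies}\quad\forall i<l\ \left(\|x-T_ix\|<\frac{1}{k+1}\right).$$ Then, for every $k\in\mathbb{N}$ and $f:\mathbb{N}\to\mathbb{N}$, $$\exists N\le\Omega(k,f)\ \forall i,j\in[N,\tilde f(N)]\ \left(\|x_i-x_j\|\le\frac{1}{k+1}\right),$$ where $\Omega(k,f)=\sigma\bigl(k_0,\tilde\phi(24K(h_{k,f}^{(E)}(0)+1)^2)\bigr)+Q$, with $$\sigma(k,n)=\sigma_2\left(\left\lceil\frac{n+\lceil\ln(12K^2(k+1))\rceil}{\gamma}\right\rceil+Q+1\right)-Q,\qquad k_0=4(k+1)^2-1,$$ $$\tilde\phi(k)=\Phi(\tau(k)),\qquad \Phi(k)=\max\{\Sigma((l+1)(k+1)-1),\Psi((l+1)(k+1)-1)\},$$ $$\Sigma(k)=\sigma_2\left(\left\lceil\frac{\psi(2k+1)+\lceil\ln(4K(k+1))\rceil}{\gamma}\right\rceil+Q+l+1\right)-l,$$ $$\psi(k)=\max\left\{\sigma_3\left(\left\lceil\frac{(b_A+1)K}{\gamma}\right\rceil(k+1)-1\right)-Q-1,0\right\},$$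 $$\Psi(k)=\max\{\sigma_1((b_A+1)K(k+1)-1)-1,0\},$$ $$E=2^83^3b_AK^2\left(\left\lceil\tfrac12 b_A\tilde K^2\right\rceil+2b_U\tilde K\right)\left\lceil\frac1\gamma\right\rceil^2(k+1)^4,\qquad \tilde K=K+b_p,$$ $$h_{k,f}(m)=\max\{\eta(k_0,\tilde\phi(K_m),\tilde f),\ \tilde f(\sigma(k_0,\tilde\phi(K_m))),\ K_m\}+1,\qquad K_m=24K(m+1)^2,$$ $$\eta(k,n,f)=\max\{24K(k+1)(f(\sigma(k,n))+1),\ f(\sigma(k,n)),\ 6k+5\},\qquad \tilde f(n)=\max_{k\le n}f(k).$$ (In $\Omega(k,f)$, $k_0$ and $E$ are computed from the given $k$.)
   Context: $\mathbb{N}=\{0,1,2,\dots\}$, $\mathbb{N}^*=\mathbb{N}\setminus\{0\}$. $[a,b]$ with $a,b\in\mathbb{N}$ denotes the set of integers $j$ with $a\le j\le b$; $g^{(j)}$ is the $j$-th iterate of $g:\mathbb{N}\to\mathbb{N}$ ($g^{(0)}=\mathrm{id}$); monotone functions on $\mathbb{N}$ are nondecreasing; subtractions are in $\mathbb{Z}$. $\overline{B}_K(p)$ is the closed ball of radius $K$ centred at $p$. Setting: $H$ is a real Hilbert space; $A$ is a self-adjoint bounded linear operator on $H$ with $\langle Ax,x\rangle\ge\gamma\|x\|^2$ for all $x\in H$, where $0<\gamma\le1$. $l\in\mathbb{N}$, $l\ge1$, and $T_0,\dots,T_{l-1}:H\to H$ are nonexpansive with $F:=\bigcap_{i=0}^{l-1}\mathrm{Fix}(T_i)\ne\emptyset$;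 for $n\ge l$, $T_n:=T_{n\bmod l}$; $\tilde T_i:=T_{i+l}\cdots T_{i+1}$ (composition) for $i\in\mathbb{N}$. $u\in H$, $(\alpha_n)_{n\in\mathbb{N}}\subset(0,1]$, and $(x_n)$ is Xu's iteration: $x_0\in H$, $x_{n+1}=(I-\alpha_{n+1}A)T_{n+1}x_n+\alpha_{n+1}u$. Take $p\in F$ and $b_A,b_U,b_p\in\mathbb{N}^*$ with $b_A\ge\|A\|$, $b_U\ge\|u\|$, $b_p\ge\|p\|$. Quantitative conditions (the rates $\sigma_i:\mathbb{N}\to\mathbb{N}$ are assumed increasing, i.e. monotone): (C1q) $\forall k\,\forall n\ge\sigma_1(k)$: $\alpha_n\le\frac1{k+1}$. (C2q) $\forall k$: $\sum_{n=0}^{\sigma_2(k)}\alpha_n\ge k$. (C3q) $\forall k\,\forall n\ge\sigma_3(k)$: $\left|\frac{\alpha_n}{\alpha_{n+l}}-1\right|\le\frac1{k+1}$. *)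

(* Defs.v *)
From HB Require Import structures.
From mathcomp Require Import all_boot all_order all_algebra.
From mathcomp Require Import all_classical all_reals all_analysis.

Set Implicit Arguments.
Unset Strict Implicit.
Unset Printing Implicit Defensive.

Import Order.TTheory GRing.Theory Num.Theory.
Import numFieldNormedType.Exports.

Local Open Scope classical_set_scope.
Local Open Scope ring_scope.

Section Operators.
Variables (R : realType) (H : normedModType R).

(* A real Hilbert space is a [completeNormedModType R] whose norm is induced by
   a positive-definite symmetric bilinear form. *)
Definition induces_norm (dot : {dot H for (@idfun R)}) : Prop :=
  forall x : H, `|x| ^+ 2 = dot x x.

Definition bounded_op (A : H -> H) : Prop :=
  exists M : R, forall x, `|A x| <= M * `|x|.

(* Only meaningful for bounded linear [A]: otherwise [sup] may default to 0. *)
Definition opnorm (A : H -> H) : R :=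
  sup [set `|A x| | x in [set x : H | `|x| <= 1]].

Definition self_adjoint (dot : {dot H for (@idfun R)}) (A : H -> H) : Prop :=
  forall x y, dot (A x) y = dot x (A y).

(* T_{i+l} o ... o T_{i+1}: the map T_{i+1} is applied first. *)
Definition Ttilde (T : nat -> H -> H) (l i : nat) (x : H) : H :=
  foldl (fun y j => T j y) x (iota i.+1 l).

End Operators.

(* Least natural number above [x], for [0 <= x]; every use below has such an
   argument. *)
Definition ceiln (R : realType) (x : R) : nat := `|Num.ceil x|%N.

Definition fmax (f : nat -> nat) (n : nat) : nat := (\max_(k < n.+1) f k)%N.

(* Subtraction on [nat] is truncated at 0, which agrees everywhere below with
   subtraction in Z: a difference [e - 1] always has [e >= 1] when [bA] and [K]
   are positive, a difference under [max (_, 0)] may be truncated, and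
   [sigma2 j - Q] and [sigma2 j - l] occur only for [j >= Q + 1] and
   [j >= l + 1] respectively, where they are nonnegative by the following
   lemma. *)
Lemma divergence_rate_ge (R : realType) (alpha : nat -> R) (sigma2 : nat -> nat) :
  (forall n, alpha n <= 1) ->
  (forall k, k%:R <= \sum_(0 <= n < (sigma2 k).+1) alpha n) ->
  forall j, (j <= (sigma2 j).+1)%N.
Proof.
move=> alpha1 div j; rewrite -(ler_nat R); apply: le_trans (div j) _.
apply: le_trans (ler_sum _ (fun n _ => alpha1 n)) _.
by rewrite sumr_const_nat subn0.
Qed.

Definition Qidx (bA : nat) (sigma1 : nat -> nat) : nat := (sigma1 (bA - 1) - 1)%N.

Section Bounds.
Variables (R : realType) (gamma : R) (l bA bU bp K : nat).
Variables (sigma1 sigma2 sigma3 tau : nat -> nat).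

Local Notation Q := (Qidx bA sigma1).

Definition psi (k : nat) : nat :=
  (sigma3 (ceiln (((bA + 1) * K)%:R / gamma) * (k + 1) - 1) - Q - 1)%N.

Definition Psi (k : nat) : nat := (sigma1 ((bA + 1) * K * (k + 1) - 1) - 1)%N.

Definition Sigma (k : nat) : nat :=
  (sigma2 (ceiln ((psi (2 * k + 1)
                   + ceiln (ln (4 * K * (k + 1))%:R : R))%:R / gamma)
           + Q + l + 1) - l)%N.

Definition Phi (k : nat) : nat :=
  maxn (Sigma ((l + 1) * (k + 1) - 1)) (Psi ((l + 1) * (k + 1) - 1)).

Definition phitilde (k : nat) : nat := Phi (tau k).

Definition sigma (k n : nat) : nat :=
  (sigma2 (ceiln ((n + ceiln (ln (12 * K ^ 2 * (k + 1))%:R : R))%:R / gamma)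
           + Q + 1) - Q)%N.

Definition k0 (k : nat) : nat := (4 * (k + 1) ^ 2 - 1)%N.

Definition eta (k n : nat) (f : nat -> nat) : nat :=
  maxn (maxn (24 * K * (k + 1) * (f (sigma k n) + 1)) (f (sigma k n)))
       (6 * k + 5).

Definition Kseq (m : nat) : nat := (24 * K * (m + 1) ^ 2)%N.

Definition h (k : nat) (f : nat -> nat) (m : nat) : nat :=
  (maxn (maxn (eta (k0 k) (phitilde (Kseq m)) (fmax f))
              (fmax f (sigma (k0 k) (phitilde (Kseq m)))))
        (Kseq m) + 1)%N.

Definition Ktilde : nat := (K + bp)%N.

Definition E (k : nat) : nat :=
  (2 ^ 8 * 3 ^ 3 * bA * K ^ 2
   * (ceiln (2^-1 * bA%:R * Ktilde%:R ^+ 2 : R) + 2 * bU * Ktilde)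
   * ceiln (1 / gamma) ^ 2 * (k + 1) ^ 4)%N.

Definition Omega (k : nat) (f : nat -> nat) : nat :=
  (sigma (k0 k) (phitilde (24 * K * (iter (E k) (h k f) 0 + 1) ^ 2)) + Q)%N.

End Bounds.

(* Main.v *)
Require Import Defs.
From HB Require Import structures.
From mathcomp Require Import all_boot all_order all_algebra.
From mathcomp Require Import all_classical all_reals all_analysis.
From mathcomp Require Import ring lra zify.

Set Implicit Arguments.
Unset Strict Implicit.
Unset Printing Implicit Defensive.

Import Order.TTheory GRing.Theory Num.Theory.
Import numFieldNormedType.Exports.

Local Open Scope classical_set_scope.
Local Open Scope ring_scope.

(* The paper's elimination of weak compactness, made quantitative. Minimise
   [energy y = <Ay,y>/2 - <u,y>] approximately over approximate common fixed
   points: if a point [y] fails [<u - Ay, z - y> <= delta] for some approximate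
   fixed point [z], then moving from [y] towards [z] lowers the energy by a fixed
   amount, and in a Hilbert space the new point is again an approximate fixed
   point, its precision dropping from [Kseq m] to [m]. The energy is bounded on
   the ball, so at most [E] such moves are possible, and some [y] with precision
   [h m], where [m = h^(i)(0)] and [i <= E], satisfies the variational inequality.

   On the other hand [x_n] is asymptotically regular, so from [phitilde] on it
   consists of approximate fixed points which may play the role of [z]. The
   resulting recursive inequality for [|x_n - y|^2] makes the iteration stay
   within [1/(2(k+1))] of [y] on [[N, fmax f N]], where [N = sigma k0 n] for
   [n = phitilde (Kseq m)]. This [n] is itself at least [Q], so the iteration need
   not be shifted by [Q]: [N], and not [N + Q], is the witness. This matters, since
   [h] only controls [fmax f] at [N]. *)

(** * Real recursions, rounding, and tails of the divergent series *)

Section Reals.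
Variable R : realType.
Implicit Types (a s : nat -> R).

(** The initial value is damped through [1 - a j <= expR (- a j)]; [r] enters with convex weights
    and so contributes at most [r] in total; the errors [v] are never amplified and add up at most
    linearly. *)
Lemma recursion_bound a s (r v : R) (m : nat) :
  (forall j, (j < m)%N -> 0 <= a j <= 1) -> 0 <= r -> 0 <= v -> 0 <= s 0%N ->
  (forall j, (j < m)%N -> s j.+1 <= (1 - a j) * (s j + v) + a j * r) ->
  s m <= expR (- \sum_(0 <= j < m) a j) * s 0%N + r + m%:R * v.
Proof.
move=> a01 r0 v0 s0; elim: m a01 => [|m IH] a01 rec.
  by rewrite big_nil oppr0 expR0; lra.
have {}IH := IH (fun j jm => a01 j (ltnW jm)) (fun j jm => rec j (ltnW jm)).
have /andP[am0 am1] := a01 m (ltnSn m).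
rewrite big_nat_recr //= opprD expRD -natr1.
set e := expR _ in IH *.
have e0 : 0 <= e by exact: expR_ge0.
have am : 1 - a m <= expR (- a m) by have := expR_ge1Dx (- a m); lra.
have es : e * (1 - a m) * s 0%N <= e * expR (- a m) * s 0%N.
  by rewrite ler_wpM2r// ler_wpM2l.
have mv : 0 <= a m * (m%:R * v + v).
  by rewrite mulr_ge0// addr_ge0// mulr_ge0.
have key : (1 - a m) * (s m + v) <= (1 - a m) * (e * s 0%N + r + m%:R * v + v).
  by rewrite ler_wpM2l//; lra.
apply: le_trans (rec m (ltnSn m)) _; nra.
Qed.

Lemma expRN_le_inv (D : nat) (S : R) :
  (0 < D)%N -> ln D%:R <= S -> expR (- S) <= 1 / D%:R.
Proof.
move=> D0 DS; rewrite expRN mul1r lef_pV2 ?posrE ?expR_gt0 ?ltr0n//.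
by rewrite -[leLHS]lnK ?posrE ?ltr0n// ler_expR.
Qed.

Lemma ceiln_ge (y : R) : 0 <= y -> y <= (ceiln y)%:R.
Proof.
move=> y0; rewrite /ceiln natr_absz ger0_norm ?ceil_ge//.
by rewrite ceil_ge0 (lt_le_trans _ y0)// ltrN10.
Qed.

Lemma le_ceiln (y z : R) : 0 <= y -> y <= z -> (ceiln y <= ceiln z)%N.
Proof.
move=> y0 yz; rewrite /ceiln; have := le_ceil yz.
have : 0 <= Num.ceil y by rewrite ceil_ge0 (lt_le_trans _ y0)// ltrN10.
lia.
Qed.

Lemma ln_nat_ge0 (D : nat) : 0 <= ln D%:R :> R.
Proof. by case: D => [|D]; [rewrite ln0 | rewrite ln_ge0// ler1n]. Qed.

Lemma le_ln_nat (C D : nat) : (0 < C)%N -> (C <= D)%N -> ln C%:R <= ln D%:R :> R.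
Proof.
by move=> C0 CD; rewrite ler_ln ?posrE ?ltr0n ?ler_nat//; apply: leq_trans CD.
Qed.

(* The last [d] terms before [M + d] are discarded at a cost of at most [d],
   because every [alpha i <= 1]. *)
Lemma divergence_tail (gamma : R) alpha (sigma2 : nat -> nat) (n c e d M : nat) :
  0 < gamma <= 1 -> (forall i, 0 < alpha i <= 1) ->
  (forall k, k%:R <= \sum_(0 <= i < (sigma2 k).+1) alpha i) ->
  (sigma2 (ceiln ((n + c)%:R / gamma : R) + e + d)%N < M + d)%N ->
  (n + e <= M)%N /\ c%:R <= gamma * \sum_(n + e <= i < M) alpha i.
Proof.
move=> /andP[g0 g1] alpha01 div; set J := (_ + d)%N => JM.
have a0 i : 0 <= alpha i by have /andP[/ltW] := alpha01 i.
have a1 i : alpha i <= 1 by have /andP[] := alpha01 i.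
have ceilP : (n + c)%:R <= gamma * (ceiln ((n + c)%:R / gamma))%:R.
  by rewrite -ler_pdivrMl// mulrC; apply/ceiln_ge/divr_ge0 => //; exact: ltW.
have neM : (n + e <= M)%N.
  (* Terms at most 1 force [J <= (sigma2 J).+1 <= M + d], while [J] is at least [n + e + d]. *)
  have := divergence_rate_ge a1 div J.
  suff : (n + c <= ceiln ((n + c)%:R / gamma))%N by lia.
  by rewrite -(ler_nat R) (le_trans ceilP)// ler_piMl.
split=> //.
have sum_le_nat i j : (i <= j)%N -> \sum_(i <= t < j) alpha t <= (j - i)%:R.
  move=> ij; apply: le_trans (ler_sum _ (fun t _ => a1 t)) _.
  by rewrite sumr_const_nat.
have JS : J%:R <= \sum_(0 <= i < M + d) alpha i.
  apply: le_trans (div J) _.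
  rewrite [leRHS](@big_cat_nat _ _ _ (sigma2 J).+1)//= lerDl.
  by apply: sumr_ge0.
have split_sum : \sum_(0 <= i < M + d) alpha i = \sum_(0 <= i < n + e) alpha i
    + \sum_(n + e <= i < M) alpha i + \sum_(M <= i < M + d) alpha i.
  rewrite -big_cat_nat//= -big_cat_nat//=; first exact: leq_addr.
have := sum_le_nat 0%N (n + e)%N isT; have := sum_le_nat M (M + d)%N (leq_addr _ _).
rewrite subn0 addKn => h1 h2; set S := (X in gamma * X).
have {JS} : J%:R <= (n + e)%:R + S + d%:R by rewrite /S; lra.
rewrite /J !natrD; set C := (ceiln _)%:R => JS.
have {JS} : C - n%:R <= S by lra.
rewrite -(ler_pM2l g0) => CS; apply: le_trans CS.
(* From [n + c <= gamma * C] and [gamma * n <= n] follows [c <= gamma * (C - n)]. *)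
have : gamma * n%:R <= n%:R by rewrite ler_piMl.
by move: ceilP; rewrite -/C natrD mulrBr; lra.
Qed.

End Reals.

(** * Inner-product identities and convexity of approximate fixed point sets *)

Section Hilbert.
Variables (R : realType) (H : normedModType R).
Variables (dot : {dot H for (@idfun R)}) (dot_norm : induces_norm dot).
Implicit Types (x y z w : H) (a t : R).

Lemma dotC x y : dot x y = dot y x.
Proof. by rewrite hermC expr0 mul1r. Qed.

Lemma dotZl t x y : dot (t *: x) y = t * dot x y.
Proof. exact: linearZl_LR. Qed.

Lemma dotZr t x y : dot x (t *: y) = t * dot x y.
Proof. exact: linearZr_LR. Qed.

Lemma dotDl x y z : dot (x + y) z = dot x z + dot y z.
Proof. exact: linearDl. Qed.

Lemma dotDr x y z : dot z (x + y) = dot z x + dot z y.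
Proof. exact: linearDr. Qed.

Lemma dotNl x y : dot (- x) y = - dot x y.
Proof. exact: linearNl. Qed.

Lemma dotNr x y : dot x (- y) = - dot x y.
Proof. exact: linearNr. Qed.

Definition dotE := (dotDl, dotDr, dotNl, dotNr, dotZl, dotZr).

Lemma normD_sqr x y : `|x + y| ^+ 2 = `|x| ^+ 2 + 2 * dot x y + `|y| ^+ 2.
Proof. by rewrite !dot_norm !dotE (dotC y x); ring. Qed.

Lemma cauchy_schwarz x y : dot x y <= `|x| * `|y|.
Proof.
have : `|x + y| ^+ 2 <= (`|x| + `|y|) ^+ 2 by rewrite lerXn2r ?nnegrE ?ler_normD.
by rewrite normD_sqr; nra.
Qed.

Lemma normD_sqr_le x y : `|x + y| ^+ 2 <= `|x| ^+ 2 + 2 * dot y (x + y).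
Proof.
rewrite normD_sqr dotDr -dot_norm (dotC y x).
by have := sqr_ge0 `|y|; lra.
Qed.

(** Taken with [q = p] to keep segments inside the ball, and with [q = S w] to estimate [w - S w],
    where the negative term is essential. *)
Lemma norm_convex_sqr t y z q :
  `|y + t *: (z - y) - q| ^+ 2 = (1 - t) * `|y - q| ^+ 2 + t * `|z - q| ^+ 2
    - t * (1 - t) * `|z - y| ^+ 2.
Proof.
by rewrite !dot_norm !dotE (dotC z y) (dotC q y) (dotC q z); ring.
Qed.

(** Nonexpansiveness puts [S w] within [e + t * n] of [y] and within [e + (1 - t) * n] of [z], for
    [n = |z - y|]. In [norm_convex_sqr] the terms in [n ^ 2] then cancel, leaving
    [4 * t * (1 - t) * e * n + e ^ 2], and [4 * t * (1 - t) <= 1]. *)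
Lemma convex_approx_fix (S : H -> H) (t e d : R) y z w :
  (forall v w, `|S v - S w| <= `|v - w|) -> 0 <= t <= 1 ->
  `|y - S y| <= e -> `|z - S z| <= e -> `|z - y| <= d ->
  w = y + t *: (z - y) -> `|w - S w| ^+ 2 <= e * (d + e).
Proof.
move=> Sne /andP[t0 t1] ye ze zyd wE.
have e0 : 0 <= e by exact: le_trans ye.
have n0 : 0 <= `|z - y| by [].
have wy : `|y - S w| <= e + t * `|z - y|.
  apply: le_trans (ler_distD (S y) _ _) _; rewrite lerD//.
  by rewrite (le_trans (Sne _ _))// wE opprD addNKr normrN normrZ ger0_norm.
have wz : `|z - S w| <= e + (1 - t) * `|z - y|.
  apply: le_trans (ler_distD (S z) _ _) _; rewrite lerD//.
  rewrite (le_trans (Sne _ _))// wE opprD addrA -{1}[z - y]scale1r -scalerBl.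
  by rewrite normrZ ger0_norm// subr_ge0.
have t2 : 0 <= 1 - t by lra.
rewrite [X in `|X - _|]wE norm_convex_sqr.
set n := `|z - y| in n0 wy wz zyd *.
have h1 : `|y - S w| ^+ 2 <= (e + t * n) ^+ 2.
  by rewrite lerXn2r ?nnegrE// (le_trans _ wy).
have h2 : `|z - S w| ^+ 2 <= (e + (1 - t) * n) ^+ 2.
  by rewrite lerXn2r ?nnegrE// (le_trans _ wz).
have h3 : (1 - t) * `|y - S w| ^+ 2 <= (1 - t) * (e + t * n) ^+ 2 by rewrite ler_wpM2l.
have h4 : t * `|z - S w| ^+ 2 <= t * (e + (1 - t) * n) ^+ 2 by rewrite ler_wpM2l.
have h5 : e * n <= e * d by rewrite ler_wpM2l.
have h6 : 4 * (t * (1 - t)) <= 1 by have := sqr_ge0 (2 * t - 1); lra.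
have h7 : 4 * (t * (1 - t)) * (e * n) <= 1 * (e * n).
  by rewrite ler_wpM2r// mulr_ge0.
apply: le_trans (_ : 4 * (t * (1 - t)) * (e * n) + e ^+ 2 <= _); last by lra.
by apply: le_trans (lerB (lerD h3 h4) (lexx _)) _; lra.
Qed.

(** * Bounds on the operator and contractivity of [I - aA] *)

Variables (A : {linear H -> H}) (bA : R).
Hypotheses (A_bounded : bounded_op A) (A_sa : self_adjoint dot A).
Hypothesis (bA_ge : opnorm A <= bA).

Lemma opnorm_bound y : `|A y| <= bA * `|y|.
Proof.
have [->|y0] := eqVneq y 0; first by rewrite linear0 !normr0 mulr0.
have ny : 0 < `|y| by rewrite normr_gt0.
rewrite -ler_pdivrMr//; apply: le_trans bA_ge.
apply: ub_le_sup.
  (* [sup] dominates its set only if that set has an upper bound, which boundedness of [A]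
     supplies. *)
  have [M AM] := A_bounded; exists `|M| => _ [z /= z1 <-].
  apply: le_trans (AM z) _; apply: le_trans (ler_wpM2r _ (ler_norm M)) _ => //.
  by rewrite ler_piMr.
exists (`|y|^-1 *: y) => /=.
  by rewrite normrZ normfV normr_id mulVf// gt_eqF.
by rewrite linearZ normrZ normfV normr_id mulrC.
Qed.

Lemma quadratic_form_le y : dot (A y) y <= bA * `|y| ^+ 2.
Proof.
apply: le_trans (cauchy_schwarz _ _) _.
by rewrite expr2 mulrA ler_wpM2r// opnorm_bound.
Qed.

Variable gamma : R.
Hypothesis A_pos : forall x, gamma * `|x| ^+ 2 <= dot (A x) x.

(* With [B = I - aA], so that [0 <= <Bv,v> <= c|v|^2], this is
   [0 <= <B(y - c^-1 By), y - c^-1 By>]. *)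
Lemma norm_contract a y : 0 <= a -> a * bA <= 1 -> a * gamma <= 1 ->
  `|y - a *: A y| <= (1 - a * gamma) * `|y|.
Proof.
move=> a0 abA ag; set c := 1 - a * gamma.
have c0 : 0 <= c by rewrite /c; lra.
pose B v := v - a *: A v; rewrite -/(B y).
have Bge0 v : 0 <= dot (B v) v.
  rewrite /B !dotE -dot_norm; have := ler_wpM2l a0 (quadratic_form_le v).
  have : a * bA * `|v| ^+ 2 <= 1 * `|v| ^+ 2 by rewrite ler_wpM2r// sqr_ge0.
  lra.
have Ble v : dot (B v) v <= c * `|v| ^+ 2.
  by rewrite /B !dotE -dot_norm; have := ler_wpM2l a0 (A_pos v); rewrite /c; lra.
have Blin v w s : B (v - s *: w) = B v - s *: B w.
  have AE : A (v - s *: w) = A v - s *: A w by rewrite linearB linearZ.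
  rewrite /B AE !scalerBr !scalerA !opprB [s * a]mulrC.
  by rewrite addrACA [RHS]addrACA [- (s *: w) - _]addrC.
have Bsa v w : dot (B v) w = dot v (B w) by rewrite /B !dotE A_sa.
clearbody B; set z := B y.
have Bquad s : 0 <= dot z y - 2 * s * `|z| ^+ 2 + s ^+ 2 * (c * `|z| ^+ 2).
  apply: le_trans (Bge0 (y - s *: z)) _.
  have -> : B (y - s *: z) = z - s *: B z by exact: Blin.
  rewrite !dotE (Bsa z y) -[B y]/z -!dot_norm.
  have := Ble z; have := sqr_ge0 s => s2 zz.
  have := ler_wpM2l s2 zz; lra.
have Bley : dot z y <= c * `|y| ^+ 2 := Ble y.
have zc : `|z| ^+ 2 <= (c * `|y|) ^+ 2.
  (* For [c = 0] there is no inverse to insert, but [s = 1] already forces [z = 0]. *)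
  have [c_eq0|cn0] := eqVneq c 0.
    have := Bquad 1; move: Bley; rewrite c_eq0 !mul0r; lra.
  have {}c0 : 0 < c by rewrite lt0r cn0.
  have := Bquad c^-1.
  have -> : c^-1 ^+ 2 * (c * `|z| ^+ 2) = c^-1 * `|z| ^+ 2 by field.
  move=> h; have {h} : c^-1 * `|z| ^+ 2 <= c * `|y| ^+ 2 by lra.
  by rewrite ler_pdivrMl// exprMn expr2 mulrA.
by rewrite -(@ler_pXn2r _ 2%N) ?nnegrE ?mulr_ge0// /c; lra.
Qed.

End Hilbert.

(** * The quadratic energy and its descent along segments *)

Section Energy.
Variables (R : realType) (H : normedModType R).
Variables (dot : {dot H for (@idfun R)}) (dot_norm : induces_norm dot).
Variables (A : {linear H -> H}) (bA : R).
Hypotheses (A_bounded : bounded_op A) (A_sa : self_adjoint dot A).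
Hypothesis (bA_ge : opnorm A <= bA).
Hypotheses (bA_gt0 : 0 < bA).
Hypothesis A_ge0 : forall y, 0 <= dot (A y) y.
Variable u : H.
Implicit Types (y z : H) (t : R).

Definition energy y : R := 2^-1 * dot (A y) y - dot u y.

(** The second-order expansion of a quadratic function is exact; self-adjointness makes [A y - u]
    the gradient at [y]. *)
Lemma energy_segment y z t : energy (y + t *: (z - y)) =
  energy y - t * dot (u - A y) (z - y) + 2^-1 * t ^+ 2 * dot (A (z - y)) (z - y).
Proof.
have [v ->] : exists v, z - y = v by exists (z - y).
rewrite /energy; have -> : A (y + t *: v) = A y + t *: A v.
  by rewrite linearD linearZ.
by rewrite !dotE [dot (A v) y]A_sa (dotC dot v); field.
Qed.

(** The step length minimises [- t * delta + 2^-1 * t ^ 2 * (4 * bA * K ^ 2)], an upper bound for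
    the change of energy, since the quadratic form at [z - y] is at most [4 * bA * K ^ 2]. *)
Lemma energy_descent (K delta : R) y z : 0 < K ->
  `|z - y| <= 2 * K -> 0 < delta < dot (u - A y) (z - y) ->
  energy (y + (delta / (4 * bA * K ^+ 2)) *: (z - y))
    <= energy y - delta ^+ 2 / (8 * bA * K ^+ 2).
Proof.
move=> K0 zyK /andP[d0 dlt]; rewrite energy_segment.
set t := delta / _.
have D0 : 0 < 4 * bA * K ^+ 2 by rewrite !mulr_gt0.
have t0 : 0 < t by rewrite divr_gt0.
have q : dot (A (z - y)) (z - y) <= 4 * bA * K ^+ 2.
  apply: le_trans (quadratic_form_le dot_norm A_bounded bA_ge _) _.
  have : `|z - y| ^+ 2 <= (2 * K) ^+ 2 by rewrite lerXn2r ?nnegrE// mulr_ge0// ltW.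
  by move=> /(ler_wpM2l (ltW bA_gt0)); lra.
have h1 : t * delta <= t * dot (u - A y) (z - y) by rewrite ler_pM2l// ltW.
have h2 : 2^-1 * t ^+ 2 * dot (A (z - y)) (z - y)
    <= 2^-1 * t ^+ 2 * (4 * bA * K ^+ 2).
  by rewrite ler_wpM2l// mulr_ge0// sqr_ge0.
have h3 : 2^-1 * t ^+ 2 * (4 * bA * K ^+ 2) - t * delta
    = - (delta ^+ 2 / (8 * bA * K ^+ 2)).
  by rewrite /t; field; rewrite !gt_eqF.
lra.
Qed.

Lemma energy_le (b bU : R) y : `|y| <= b -> `|u| <= bU ->
  energy y <= 2^-1 * bA * b ^+ 2 + bU * b.
Proof.
move=> yb ub; rewrite /energy.
have := quadratic_form_le dot_norm A_bounded bA_ge y.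
have := cauchy_schwarz dot_norm (- u) y; rewrite dotNl normrN.
have : `|u| * `|y| <= bU * b by rewrite ler_pM.
have : bA * `|y| ^+ 2 <= bA * b ^+ 2.
  by rewrite ler_pM2l// lerXn2r ?nnegrE// (le_trans _ yb).
lra.
Qed.

Lemma energy_ge (b bU : R) y : `|y| <= b -> `|u| <= bU -> - (bU * b) <= energy y.
Proof.
move=> yb ub; rewrite /energy.
have := cauchy_schwarz dot_norm u y.
have : `|u| * `|y| <= bU * b by rewrite ler_pM.
have := A_ge0 y; lra.
Qed.

(** * Approximate minimisation over approximate common fixed points *)

Variables (T : nat -> H -> H) (l : nat) (p : H) (K : nat) (bU bp delta : R).
Hypothesis T_nonexp : forall i v w, (i < l)%N -> `|T i v - T i w| <= `|v - w|.
Hypothesis T_fix : forall i, (i < l)%N -> T i p = p.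
Hypotheses (K_gt0 : (0 < K)%N) (u_le : `|u| <= bU) (p_le : `|p| <= bp).
Hypotheses (delta_gt0 : 0 < delta) (delta_le : delta <= 4 * bA * K%:R ^+ 2).

(** [convex_approx_fix] bounds the square of the new defect by [e * (2 * K + e)]; taking a root
    explains why [Kseq] is quadratic in [m + 1] and linear in [K]. *)
Lemma approx_fix_segment (m n : nat) (t : R) y z : (Kseq K m <= n)%N ->
  0 <= t <= 1 -> `|y - p| <= K%:R -> `|z - p| <= K%:R ->
  (forall i, (i < l)%N -> `|y - T i y| <= 1 / (n + 1)%:R) ->
  (forall i, (i < l)%N -> `|z - T i z| <= 1 / (Kseq K m + 1)%:R) ->
  let w := y + t *: (z - y) in
  `|w - p| <= K%:R /\ forall i, (i < l)%N -> `|w - T i w| <= 1 / (m + 1)%:R.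
Proof.
move=> Kn t01 yK zK yT zT; split.
  rewrite -(@ler_pXn2r _ 2%N) ?nnegrE// (norm_convex_sqr dot_norm).
  have /andP[t0 t1] := t01.
  have h v : `|v - p| <= K%:R -> `|v - p| ^+ 2 <= K%:R ^+ 2.
    by move=> vK; rewrite lerXn2r ?nnegrE.
  have t2 : 0 <= 1 - t by lra.
  have := ler_wpM2l t0 (h _ zK); have := ler_wpM2l t2 (h _ yK).
  have : 0 <= t * (1 - t) * `|z - y| ^+ 2 by rewrite !mulr_ge0 ?sqr_ge0.
  by rewrite /=; lra.
move=> i il; set e : R := 1 / (Kseq K m + 1)%:R.
have yTe : `|y - T i y| <= e.
  apply: le_trans (yT i il) _; rewrite ler_pM2l// lef_pV2 ?posrE ?ltr0n ?addn1//.
  by rewrite ler_nat ltnS.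
have zy : `|z - y| <= 2 * K%:R.
  by rewrite (le_trans (ler_distD p _ _))// [`|p - y|]distrC; lra.
rewrite -(@ler_pXn2r _ 2%N) ?nnegrE ?divr_ge0//.
apply: le_trans
  (convex_approx_fix dot_norm (fun v w => T_nonexp v w il) t01 yTe (zT i il) zy erefl) _.
have K1 : 1 <= K%:R :> R by rewrite ler1n.
have e0 : 0 < e by rewrite divr_gt0// ltr0n addn1.
pose q : R := (m + 1)%:R ^+ 2.
have q1 : 1 <= q by rewrite exprn_ege1// ler1n addn1.
have eE : e * (24 * K%:R * q + 1) = 1.
  have -> : 24 * K%:R * q + 1 = (Kseq K m + 1)%:R by rewrite natrD natrM natrX natrM.
  by rewrite /e divfK// pnatr_eq0 addn1.
have -> : (1 / (m + 1)%:R : R) ^+ 2 = q^-1 by rewrite expr_div_n expr1n div1r.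
rewrite -[q^-1]mul1r ler_pdivlMr; last by lra.
have eKq : 0 <= e * (K%:R - 1) * q by rewrite !mulr_ge0//; lra.
have e1 : e <= 1.
  by rewrite /e ler_pdivrMr ?mul1r ?ler1n ?ltr0n addn1.
have : e * e * q <= e * 1 * q by rewrite ler_wpM2r ?ler_wpM2l//; lra.
have : 0 <= e * q by rewrite mulr_ge0; lra.
by lra.
Qed.

Variables (h : nat -> nat) (E : nat).
Hypothesis h_ge : forall m, (Kseq K m <= h m)%N.
Hypothesis E_ge : 2^-1 * bA * (K%:R + bp) ^+ 2 + 2 * bU * (K%:R + bp)
  <= E%:R * (delta ^+ 2 / (8 * bA * K%:R ^+ 2)).

(* If the conclusion fails for every [m = h^(i)(0)], [i <= E], then descending
   from [i = E] to [i = 0], starting from [p], the energy decreases [E + 1]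
   times by a fixed amount, more than its oscillation on the ball allows. *)
Lemma quasi_minimizer : exists i y, let m := iter i h 0%N in
  [/\ (i <= E)%N, `|y - p| <= K%:R,
      forall j, (j < l)%N -> `|y - T j y| <= 1 / (h m + 1)%:R &
      forall z, `|z - p| <= K%:R ->
        (forall j, (j < l)%N -> `|z - T j z| <= 1 / (Kseq K m + 1)%:R) ->
        dot (u - A y) (z - y) <= delta].
Proof.
apply: contrapT => none; have rangeE := E_ge; set eps : R := _ / _ in rangeE.
have K0 : 0 < K%:R :> R by rewrite ltr0n.
have eps0 : 0 < eps by rewrite divr_gt0 ?exprn_gt0// !mulr_gt0// exprn_gt0.
(* The number [n] of moves counts up while the iterate of [h] counts down: each move spends one
   application of [h] in precision. *)
have step n : (n <= E.+1)%N -> exists y, [/\ `|y - p| <= K%:R,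
    forall j, (j < l)%N -> `|y - T j y| <= 1 / (iter (E.+1 - n) h 0%N + 1)%:R &
    energy y <= energy p - n%:R * eps].
  elim: n => [_|n IH nE].
    exists p; split; first by rewrite subrr normr0.
      by move=> j jl; rewrite T_fix// subrr normr0 divr_ge0.
    by rewrite mul0r subr0.
  have [y [yK yT ye]] := IH (ltnW nE).
  rewrite subSS; set i := (E - n)%N; pose m := iter i h 0%N.
  have mE : iter (E.+1 - n) h 0%N = h m.
    by rewrite /m -iterS /i subSn// -ltnS.
  rewrite mE in yT.
  have [z [zK zT dz]] : exists z, [/\ `|z - p| <= K%:R,
      forall j, (j < l)%N -> `|z - T j z| <= 1 / (Kseq K m + 1)%:R &
      delta < dot (u - A y) (z - y)].
    apply: contrapT => noz; apply: none; exists i, y; split=> //; first exact: leq_subr.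
    move=> z zK zT; rewrite leNgt; apply/negP => dz; apply: noz; by exists z.
  pose t := delta / (4 * bA * K%:R ^+ 2).
  have D0 : 0 < 4 * bA * K%:R ^+ 2 by rewrite !mulr_gt0// exprn_gt0.
  (* [delta_le] keeps the descent step from overshooting [z]. *)
  have t01 : 0 <= t <= 1.
    by rewrite divr_ge0 ?(ltW delta_gt0) ?(ltW D0)//= ler_pdivrMr// mul1r.
  have [wK wT] := approx_fix_segment (h_ge m) t01 yK zK yT zT.
  exists (y + t *: (z - y)); split=> //.
  have zy : `|z - y| <= 2 * K%:R.
    by rewrite (le_trans (ler_distD p _ _))// [`|p - y|]distrC; lra.
  have := @energy_descent K%:R delta y z K0 zy; rewrite delta_gt0 dz => /(_ isT).
  by rewrite -/eps -/t -natr1; lra.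
(* The [E.+1] moves would lower the energy by [E.+1 * eps], but it can drop by at most [E * eps];
   [2 * bU] collects the linear term from the upper bound at [p] and from the lower bound at [y]. *)
have [y [yK _ ye]] := step E.+1 (leqnn _).
have b_le v : `|v - p| <= K%:R -> `|v| <= K%:R + bp.
  move=> vK; rewrite -[v](subrK p) (le_trans (ler_normD _ _))// lerD//.
have := energy_ge (b_le _ yK) u_le.
have pK : `|p - p| <= K%:R by rewrite subrr normr0.
have := energy_le (b_le _ pK) u_le.
move: ye rangeE; rewrite -natr1; lra.
Qed.

End Energy.

(** * Xu's iteration: boundedness and distance to a quasi-minimiser *)

Section Iteration.
Variables (R : realType) (H : normedModType R).
Variables (dot : {dot H for (@idfun R)}) (dot_norm : induces_norm dot).
Variables (A : {linear H -> H}) (gamma : R) (bA : nat).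
Hypotheses (A_bounded : bounded_op A) (A_sa : self_adjoint dot A).
Hypotheses (gamma_gt0 : 0 < gamma) (gamma_le1 : gamma <= 1).
Hypothesis A_pos : forall y : H, gamma * `|y| ^+ 2 <= dot (A y) y.
Hypotheses (bA_gt0 : (0 < bA)%N) (bA_ge : opnorm A <= bA%:R).
Variables (T : nat -> H -> H) (p u : H) (alpha : nat -> R).
Hypothesis T_nonexp : forall n v w, `|T n v - T n w| <= `|v - w|.
Hypothesis T_fix : forall n, T n p = p.
Hypothesis alpha01 : forall n, 0 < alpha n <= 1.
Variable x : nat -> H.
Hypothesis x_rec : forall n, x n.+1 =
  (T n.+1 (x n) - alpha n.+1 *: A (T n.+1 (x n))) + alpha n.+1 *: u.
Variables (sigma1 sigma2 : nat -> nat).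
Hypothesis C1q : forall k n, (sigma1 k <= n)%N -> alpha n <= 1 / (k + 1)%:R.
Hypothesis C2q : forall k, k%:R <= \sum_(0 <= n < (sigma2 k).+1) alpha n.
Variable K : nat.
Local Notation Q := (Qidx bA sigma1).
Hypotheses (K_gt0 : (0 < K)%N) (xQ_le : `|x Q - p| <= K%:R).
Hypothesis uAp_le : `|u - A p| <= gamma * K%:R.

Let alpha_gt0 n : 0 < alpha n. Proof. by have /andP[] := alpha01 n. Qed.
Let alpha_le1 n : alpha n <= 1. Proof. by have /andP[] := alpha01 n. Qed.
Let alphag_le1 n : alpha n * gamma <= 1.
Proof. by rewrite mulr_ile1// ltW. Qed.

(** Separates the contraction [I - alpha A] from the drift [u - A q]. The point [q] is free: it will
    be [p], the quasi-minimiser, or a value of some [T n]. *)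
Lemma xu_sub n q : x n.+1 - q =
  ((T n.+1 (x n) - q) - alpha n.+1 *: A (T n.+1 (x n) - q))
    + alpha n.+1 *: (u - A q).
Proof.
rewrite x_rec linearB /=; set v := T _ _; set Av := A v.
rewrite !scalerBr opprB -[RHS]addrA [in RHS](addrC (_ - _) (_ - _)) subrKA.
by rewrite addrAC (addrAC v) -addrA (addrC (- _)).
Qed.

Lemma xu_defect n :
  x n.+1 - T n.+1 (x n) = alpha n.+1 *: (u - A (T n.+1 (x n))).
Proof. by rewrite xu_sub subrr linear0 scaler0 subrr add0r. Qed.

(** From [Q] on, the index [n.+1] is past [sigma1 (bA - 1)], so [alpha n.+1 <= 1 / bA], as
    [norm_contract] requires. *)
Lemma xu_contract n v : (Q <= n)%N ->
  `|v - alpha n.+1 *: A v| <= (1 - alpha n.+1 * gamma) * `|v|.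
Proof.
move=> Qn; apply: (norm_contract dot_norm A_bounded A_sa bA_ge A_pos) => //.
  exact: ltW.
have : (sigma1 (bA - 1) <= n.+1)%N by move: Qn; rewrite /Qidx; lia.
move=> /C1q; rewrite subnK// => aA.
by rewrite -ler_pdivlMr ?ltr0n.
Qed.

(** The new distance is at most [(1 - alpha * gamma) * K + alpha * (gamma * K) = K]. *)
Lemma xu_bounded n : (Q <= n)%N -> `|x n - p| <= K%:R.
Proof.
move/subnK <-; elim: (n - Q)%N => [//|i IH].
rewrite addSn xu_sub; set m := (i + Q)%N in IH *.
have Qm : (Q <= m)%N by exact: leq_addl.
apply: le_trans (ler_normD _ _) _.
rewrite normrZ (gtr0_norm (alpha_gt0 _)).
have h1 := xu_contract (T m.+1 (x m) - p) Qm.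
have h2 : `|T m.+1 (x m) - p| <= K%:R.
  by rewrite -{1}(T_fix m.+1) (le_trans (T_nonexp _ _ _)).
have h3 : 0 <= 1 - alpha m.+1 * gamma by rewrite subr_ge0.
have := ler_wpM2l h3 h2; have := ler_wpM2l (ltW (alpha_gt0 m.+1)) uAp_le.
lra.
Qed.

Lemma xu_distance_le q n : `|q - p| <= K%:R -> (Q <= n)%N ->
  `|x n - q| <= 2 * K%:R.
Proof.
move=> qK Qn; rewrite (le_trans (ler_distD p _ _))// [`|p - _|]distrC.
by have := xu_bounded Qn; lra.
Qed.

(** Squaring [|x n - q| + e] costs at most [4 * K * e + 2 * K * e]. By [normD_sqr_le] the drift
    appears only in an inner product with the next iterate, which the variational inequality
    controls. *)
Lemma xu_distance_step q n (e : R) : `|q - p| <= K%:R -> (Q <= n)%N ->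
  `|q - T n.+1 q| <= e -> e <= 2 * K%:R ->
  `|x n.+1 - q| ^+ 2 <=
    (1 - alpha n.+1 * gamma) * (`|x n - q| ^+ 2 + 6 * K%:R * e)
    + 2 * alpha n.+1 * dot (u - A q) (x n.+1 - q).
Proof.
move=> qK Qn Tq eK; have e0 : 0 <= e by exact: le_trans Tq.
have sub_q := xu_sub n q; set b := _ *: (u - A q) in sub_q.
set v := T n.+1 (x n) - q in sub_q.
rewrite {1}sub_q; apply: le_trans (normD_sqr_le dot_norm _ _) _.
rewrite -sub_q /b dotZl mulrA lerD2r.
have a1 : 0 <= 1 - alpha n.+1 * gamma by rewrite subr_ge0.
have xq := xu_distance_le qK Qn.
have vle : `|v| <= `|x n - q| + e.
  rewrite (le_trans (ler_distD (T n.+1 q) _ _))// lerD ?T_nonexp//.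
  by rewrite distrC.
have v2 : `|v| ^+ 2 <= `|x n - q| ^+ 2 + 6 * K%:R * e.
  apply: le_trans (_ : (`|x n - q| + e) ^+ 2 <= _).
    by rewrite lerXn2r ?nnegrE// (le_trans _ vle).
  have := ler_wpM2r e0 xq; have := ler_wpM2r e0 eK; lra.
apply: le_trans (_ : ((1 - alpha n.+1 * gamma) * `|v|) ^+ 2 <= _).
  by rewrite lerXn2r ?nnegrE ?mulr_ge0// xu_contract.
rewrite exprMn expr2 -mulrA ler_wpM2l// (le_trans _ v2)// ler_piMl ?sqr_ge0//.
by rewrite gerBl mulr_ge0// ltW.
Qed.

(** The target is split into three shares: the initial square, at most [4 * K ^ 2], is damped to a
    third; the inner products give another third; at most [M] errors of size [6 * K * e] give a
    quarter. *)
Lemma xu_near q k n i M : `|q - p| <= K%:R -> (Q <= n)%N ->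
  (forall j, `|q - T j q| <= 1 / (24 * K * (k + 1) * (M + 1))%:R) ->
  (forall j, (n <= j)%N -> dot (u - A q) (x j - q) <= gamma / (6 * (k + 1))%:R) ->
  (sigma gamma bA K sigma1 sigma2 k n <= i <= M)%N ->
  `|x i - q| ^+ 2 <= 1 / (k + 1)%:R.
Proof.
rewrite /sigma; set c := ceiln (ln _) => qK Qn Tq dq /andP[ni iM].
have g01 : 0 < gamma <= 1 by rewrite gamma_gt0.
(* [e = 1] because the first weight is [alpha n.+1]; [d = Q] pays for the subtraction of [Q] in
   [sigma]. *)
have [|{}ni sumP] := @divergence_tail R gamma alpha sigma2 n c 1 Q
    (i + 1) g01 alpha01 C2q.
  by rewrite -addnA (addnC 1%N) addnA; lia.
rewrite leq_add2r in ni.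
pose s j := `|x (n + j)%N - q| ^+ 2.
pose a j := alpha (n + j).+1 * gamma.
set e : R := 1 / _ in Tq.
have K1 : 1 <= K%:R :> R by rewrite ler1n.
pose r : R := 3^-1 * (1 / (k + 1)%:R).
have k1 : 0 < (k + 1)%:R :> R by rewrite ltr0n addn1.
have M1 : 0 < (M + 1)%:R :> R by rewrite ltr0n addn1.
have e0 : 0 <= e by rewrite divr_ge0.
have eE : e = 1 / (24 * K%:R * (k + 1)%:R * (M + 1)%:R) by rewrite /e !natrM.
have e1 : e <= 1.
  by rewrite ler_pdivrMr ?mul1r ?ler1n ?ltr0n ?muln_gt0 ?K_gt0 ?addn1.
have := @recursion_bound R a s r (6 * K%:R * e) (i - n).
rewrite /s /= subnKC//; set S := \sum_(_ <= _ < _) _ => main.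
have SE : S = gamma * \sum_(n + 1 <= t < i + 1) alpha t.
  rewrite -[(n + 1)%N]add0n big_addn mulr_sumr /S subnDr.
  by apply: eq_bigr => j _; rewrite /a mulrC addnC -addSn addn1 addnS addSn.
have eS : expR (- S) <= 1 / (12 * K ^ 2 * (k + 1))%:R.
  apply: expRN_le_inv; first by rewrite !muln_gt0 K_gt0 addn1.
  by rewrite SE (le_trans _ sumP)// ceiln_ge// ln_nat_ge0.
have s0 : `|x n - q| ^+ 2 <= (2 * K%:R) ^+ 2.
  by rewrite lerXn2r ?nnegrE ?mulr_ge0// xu_distance_le.
have r0 : 0 <= r by rewrite mulr_ge0 ?divr_ge0.
apply: le_trans (main _ _ _ _ _) _ => //.
- by move=> j _; rewrite /a mulr_ge0 ?(ltW gamma_gt0) ?(ltW (alpha_gt0 _))//=.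
- by rewrite !mulr_ge0.
- move=> j _; rewrite addnS.
  have Qj : (Q <= n + j)%N by exact: leq_trans (leq_addr _ _).
  have eK : e <= 2 * K%:R by lra.
  apply: le_trans (xu_distance_step qK Qj (Tq _) eK) _; rewrite lerD2l /a.
  have := dq (n + j).+1 (leqW (leq_addr _ _)).
  have -> : gamma / (6 * (k + 1))%:R = 2^-1 * gamma * r.
    rewrite /r natrM; move: k1; move: ((k + 1)%:R : R) => b b0.
    by field; rewrite gt_eqF.
  move=> /(ler_wpM2l (ltW (alpha_gt0 (n + j).+1))); lra.
rewrite addn0.
have h1 := ler_pM (expR_ge0 _) (sqr_ge0 _) eS s0.
have h2 : 1 / (12 * K ^ 2 * (k + 1))%:R * (2 * K%:R) ^+ 2 = r.
  rewrite natrM natrM natrX /r; move: k1 K1; move: (k + 1)%:R K%:R => b c' b0 c0.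
  by field; rewrite !gt_eqF//; lra.
have h3 : (i - n)%:R * (6 * K%:R * e) <= 4^-1 * (1 / (k + 1)%:R).
  have -> : 6 * K%:R * e = (4^-1 * (1 / (k + 1)%:R)) / (M + 1)%:R.
    rewrite eE; move: k1 K1 M1.
    move: (k + 1)%:R K%:R (M + 1)%:R => b c' d b0 c0 d0.
    by field; rewrite !gt_eqF//; lra.
  rewrite mulrCA ler_piMr ?mulr_ge0 ?divr_ge0// ler_pdivrMr// mul1r ler_nat.
  by rewrite (leq_trans (leq_subr _ _))// (leq_trans iM)// leq_addr.
have := divr_ge0 ler01 (ltW k1).
by rewrite -/r /r in h2 *; lra.
Qed.

(** * Asymptotic regularity of the iteration *)

Lemma xu_drift n : (Q <= n)%N ->
  `|u - A (T n.+1 (x n))| <= ((bA + 1) * K)%:R.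
Proof.
move=> Qn; apply: le_trans (ler_distD (A p) _ _) _.
rewrite -linearB natrM natrD mulrDl mul1r addrC lerD//.
  apply: le_trans (opnorm_bound A_bounded bA_ge _) _.
  rewrite ler_wpM2l// distrC -{1}(T_fix n.+1) (le_trans (T_nonexp _ _ _))//.
  exact: xu_bounded.
by rewrite (le_trans uAp_le)// ler_piMl.
Qed.

Hypothesis sigma1_mono : {homo sigma1 : m n / (m <= n)%N}.

Lemma xu_step_regular k n : (Psi bA K sigma1 k <= n)%N ->
  (Q <= n)%N /\ `|x n.+1 - T n.+1 (x n)| <= 1 / (k + 1)%:R.
Proof.
rewrite /Psi => Pn.
have Qn : (Q <= n)%N.
  apply: leq_trans Pn; apply/leq_sub2r/sigma1_mono/leq_sub2r.
  by rewrite -[leqLHS]muln1 -mulnA leq_mul ?addn1 ?muln_gt0 ?K_gt0// leqnSn.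
split=> //; rewrite xu_defect normrZ.
rewrite (gtr0_norm (alpha_gt0 _)).
have B0 : (0 < (bA + 1) * K)%N by rewrite muln_gt0 K_gt0 addn1.
have /C1q : (sigma1 ((bA + 1) * K * (k + 1) - 1) <= n.+1)%N by lia.
rewrite subnK; last by rewrite muln_gt0 B0 addn1.
rewrite natrM => an.
apply: le_trans (ler_wpM2l (ltW (alpha_gt0 _)) (xu_drift Qn)) _.
have B0' : 0 < ((bA + 1) * K)%:R :> R by rewrite ltr0n.
rewrite -ler_pdivlMr// (le_trans an)//.
by rewrite !div1r invfM mulrC.
Qed.

(** Each further map adds one defect [e], and nonexpansiveness keeps the earlier ones from growing.
    The length [m] is general for the induction. *)
Lemma Ttilde_close n m (e : R) :
  (forall i, (n <= i)%N -> `|x i.+1 - T i.+1 (x i)| <= e) ->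
  `|x (n + m)%N - foldl (fun y j => T j y) (x n) (iota n.+1 m)| <= m%:R * e.
Proof.
move=> xT; elim: m => [|m IH]; first by rewrite addn0 subrr normr0 mul0r.
rewrite -{2}(addn1 m) iotaD foldl_cat /= addnS addSn -natr1 mulrDl mul1r.
apply: le_trans (ler_distD (T (n + m).+1 (x (n + m)%N)) _ _) _.
by rewrite addrC lerD// ?xT ?leq_addr// (le_trans (T_nonexp _ _ _)).
Qed.

Variables (l : nat) (sigma3 : nat -> nat).
Hypothesis T_periodic : forall n, T (n + l)%N = T n.
Hypothesis C3q : forall k n, (sigma3 k <= n)%N ->
  `|alpha n / alpha (n + l)%N - 1| <= 1 / (k + 1)%:R.

(** The ceiling [C] absorbs [(bA + 1) * K / gamma], so the ratio condition yields a perturbation of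
    the form [a * r] that [recursion_bound] accepts. *)
Lemma psi_small k i :
  (psi gamma bA K sigma1 sigma3 k + Q <= i)%N ->
  `|alpha (i.+1 + l)%N - alpha i.+1| * ((bA + 1) * K)%:R
    <= alpha (i.+1 + l)%N * gamma * (1 / (k + 1)%:R).
Proof.
rewrite /psi; set C := ceiln _ => Ni.
have B0 : 0 < ((bA + 1) * K)%:R :> R by rewrite ltr0n muln_gt0 K_gt0 addn1.
have CB : ((bA + 1) * K)%:R <= gamma * C%:R.
  by rewrite mulrC -ler_pdivrMr// ceiln_ge// divr_ge0// ltW.
have C0 : 0 < C%:R :> R.
  by rewrite -(pmulr_rgt0 _ gamma_gt0) (lt_le_trans B0).
have /C3q : (sigma3 (C * (k + 1) - 1) <= i.+1)%N by lia.
rewrite subnK; last by rewrite muln_gt0 addn1 andbT -(ltr0n R).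
set a := alpha (_ + l)%N; have a0 : 0 < a by exact: alpha_gt0.
have -> : alpha i.+1 / a - 1 = (alpha i.+1 - a) / a by field; rewrite gt_eqF.
rewrite normrM normfV (gtr0_norm a0) distrC ler_pdivrMr// natrM => aC.
apply: le_trans (ler_wpM2r (ltW B0) aC) _.
have k0 : 0 < (k + 1)%:R :> R by rewrite ltr0n addn1.
have -> : 1 / (C%:R * (k + 1)%:R) * a * ((bA + 1) * K)%:R
  = (a * (1 / (k + 1)%:R)) * (((bA + 1) * K)%:R / C%:R).
  by field; rewrite !gt_eqF.
rewrite [leRHS]mulrAC ler_wpM2l ?mulr_ge0 ?divr_ge0 ?(ltW a0) ?(ltW k0)//.
by rewrite ler_pdivrMr.
Qed.

(** By periodicity both iterates are moved by the same map, so only the change of [alpha],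
    multiplied by the drift, perturbs the contraction. *)
Lemma xu_shift_step i : (Q <= i)%N ->
  `|x (i.+1 + l)%N - x i.+1| <=
    (1 - alpha (i.+1 + l)%N * gamma) * `|x (i + l)%N - x i|
    + `|alpha (i.+1 + l)%N - alpha i.+1| * ((bA + 1) * K)%:R.
Proof.
move=> Qi; set v := T i.+1 (x i); set w := T i.+1 (x (i + l)%N).
have -> : x (i.+1 + l)%N - x i.+1 = (w - v - alpha (i.+1 + l)%N *: A (w - v))
    + (alpha (i.+1 + l)%N - alpha i.+1) *: (u - A v).
  rewrite scalerBl -xu_defect -/v opprB addrA addSn.
  by rewrite -[LHS](subrKA v) xu_sub -addSn T_periodic.
apply: le_trans (ler_normD _ _) _; rewrite normrZ lerD//; last first.
  by rewrite ler_wpM2l// xu_drift.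
rewrite addSn; have Qil : (Q <= i + l)%N by exact: leq_trans (leq_addr _ _).
apply: le_trans (xu_contract _ Qil) _.
by rewrite ler_wpM2l ?T_nonexp// subr_ge0.
Qed.

(** [recursion_bound] with [v = 0]: the damped initial distance, originally at most [2 * K], and [r]
    each take half of the target. *)
Lemma xu_shift_regular k n : (Sigma gamma l bA K sigma1 sigma2 sigma3 k <= n)%N ->
  `|x (n + l)%N - x n| <= 1 / (k + 1)%:R.
Proof.
rewrite /Sigma; set N := psi _ _ _ _ _ _; set c := ceiln (ln _) => Sn.
have g01 : 0 < gamma <= 1 by rewrite gamma_gt0.
(* The weights are shifted by [l] and start at [N + Q + l + 1]; no terms are discarded, since
   [n + l] already matches the subtraction of [l] in [Sigma]. *)
have [|Nn sumP] := @divergence_tail R gamma alpha sigma2 N c (Q + l + 1) 0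
    (n + l + 1) g01 alpha01 C2q.
  by rewrite addn0 !addnA; lia.
have NQn : (N + Q <= n)%N by lia.
pose s j := `|x (N + Q + j + l)%N - x (N + Q + j)%N|.
pose a j := alpha ((N + Q + j).+1 + l)%N * gamma.
pose r : R := 1 / (2 * k + 1 + 1)%:R.
have Qi j : (Q <= N + Q + j)%N by rewrite -addnA addnCA leq_addr.
have := @recursion_bound R a s r 0 (n - (N + Q)).
rewrite /s /= subnKC// mulr0 !addr0; set S := \sum_(_ <= _ < _) _ => main.
have SE : S = gamma * \sum_(N + (Q + l + 1) <= i < n + l + 1) alpha i.
  rewrite -[(N + _)%N]add0n big_addn mulr_sumr /S.
  have -> : (n + l + 1 - (N + (Q + l + 1)) = n - (N + Q))%N.
    by rewrite -!addnA (addnA N) subnDr.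
  apply: eq_bigr => j _; rewrite /a mulrC; congr (_ * alpha _).
  by clear; lia.
have eS : expR (- S) <= 1 / (4 * K * (k + 1))%:R.
  apply: expRN_le_inv; first by rewrite !muln_gt0 K_gt0 addn1.
  by rewrite SE (le_trans _ sumP)// ceiln_ge// ln_nat_ge0.
have s0 : `|x (N + Q + l)%N - x (N + Q)%N| <= 2 * K%:R.
  have h1 := @xu_bounded (N + Q)%N (leq_addl _ _).
  have h2 : `|x (N + Q + l)%N - p| <= K%:R.
    by rewrite xu_bounded// -addnA addnCA leq_addr.
  by rewrite (le_trans (ler_distD p _ _))// [`|p - _|]distrC; lra.
apply: le_trans (main _ _ _ _ _) _ => //.
- move=> j _; rewrite /a mulr_ge0 ?(ltW gamma_gt0) ?(ltW (alpha_gt0 _))//=.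
- by rewrite divr_ge0.
- move=> j _; rewrite addr0 addnS.
  have := @psi_small (2 * k + 1) (N + Q + j) (leq_addr _ _).
  have := xu_shift_step (Qi j).
  by rewrite -/r /a; lra.
have := ler_pM (expR_ge0 _) (normr_ge0 _) eS s0.
have K0 : 0 < K%:R :> R by rewrite ltr0n.
have k0 : 0 < k%:R + 1 :> R by rewrite ltr_wpDl.
have -> : 1 / (4 * K * (k + 1))%:R * (2 * K%:R) = 2^-1 * (1 / (k + 1)%:R) :> R.
  by rewrite !natrM natrD; field; rewrite !gt_eqF.
have -> : r = 2^-1 * (1 / (k + 1)%:R).
  rewrite /r; have -> : (2 * k + 1 + 1 = 2 * (k + 1))%N by clear; lia.
  by rewrite natrM !div1r invfM.
rewrite addn0; lra.
Qed.

(** The factor [l + 1] in [Phi] shares the target between one shift by [l] and [l] single-step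
    defects. *)
Lemma xu_Ttilde_regular k n :
  (Phi gamma l bA K sigma1 sigma2 sigma3 k <= n)%N ->
  (Q <= n)%N /\ `|x n - Ttilde T l n (x n)| <= 1 / (k + 1)%:R.
Proof.
rewrite /Phi geq_max => /andP[Sn Pn].
set k' := ((l + 1) * (k + 1) - 1)%N in Sn Pn.
have [Qn _] := xu_step_regular Pn; split=> //.
have h1 := xu_shift_regular Sn.
have h2 : `|x (n + l)%N - Ttilde T l n (x n)| <= l%:R * (1 / (k' + 1)%:R).
  by apply: Ttilde_close => i ni; have [] := xu_step_regular (leq_trans Pn ni).
apply: le_trans (ler_distD (x (n + l)%N) _ _) _; rewrite distrC.
apply: le_trans (lerD h1 h2) _.
rewrite /k' subnK; last by rewrite muln_gt0 !addn1.
have -> : l%:R = (l + 1)%:R - 1 :> R by rewrite natrD addrK.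
rewrite natrM; have : (l + 1)%:R != 0 :> R by rewrite pnatr_eq0 addn1.
have : (k + 1)%:R != 0 :> R by rewrite pnatr_eq0 addn1.
move: ((l + 1)%:R : R) ((k + 1)%:R : R) => a b b0 a0.
suff -> : 1 / (a * b) + (a - 1) * (1 / (a * b)) = 1 / b by [].
by field; rewrite a0 b0.
Qed.

End Iteration.

(** * Monotonicity of the rates and size of the constants *)

Section Monotonicity.
Variables (R : realType) (gamma : R) (l bA bU bp K : nat).
Variables (sigma1 sigma2 sigma3 tau : nat -> nat).
Hypothesis gamma_gt0 : 0 < gamma.
Hypothesis K_gt0 : (0 < K)%N.
Hypothesis sigma1_mono : {homo sigma1 : m n / (m <= n)%N}.
Hypothesis sigma2_mono : {homo sigma2 : m n / (m <= n)%N}.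
Hypothesis sigma3_mono : {homo sigma3 : m n / (m <= n)%N}.
Hypothesis tau_mono : {homo tau : m n / (m <= n)%N}.

Lemma le_ceiln_nat_div m n : (m <= n)%N ->
  (ceiln (m%:R / gamma) <= ceiln (n%:R / gamma))%N.
Proof.
move=> mn; apply: le_ceiln; first by rewrite divr_ge0// ltW.
by rewrite ler_pM2r ?invr_gt0// ler_nat.
Qed.

Lemma psi_mono : {homo psi gamma bA K sigma1 sigma3 : m n / (m <= n)%N}.
Proof.
move=> m n mn; rewrite /psi !leq_sub2r//; apply: sigma3_mono.
by rewrite leq_sub2r// leq_mul2l leq_add2r mn orbT.
Qed.

Lemma Psi_mono : {homo Psi bA K sigma1 : m n / (m <= n)%N}.
Proof.
move=> m n mn; rewrite /Psi leq_sub2r//; apply: sigma1_mono.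
by rewrite leq_sub2r// leq_mul2l leq_add2r mn orbT.
Qed.

Lemma Sigma_mono : {homo Sigma gamma l bA K sigma1 sigma2 sigma3 : m n / (m <= n)%N}.
Proof.
move=> m n mn; rewrite /Sigma leq_sub2r//; apply: sigma2_mono.
rewrite !leq_add2r; apply: le_ceiln_nat_div; apply: leq_add.
  by apply: psi_mono; rewrite leq_add2r leq_mul2l mn orbT.
apply: le_ceiln; first exact: ln_nat_ge0.
apply: le_ln_nat; first by rewrite !muln_gt0 K_gt0 addn1.
by rewrite leq_mul2l leq_add2r mn orbT.
Qed.

Lemma phitilde_mono :
  {homo phitilde gamma l bA K sigma1 sigma2 sigma3 tau : m n / (m <= n)%N}.
Proof.
move=> m n /tau_mono mn; rewrite /phitilde /Phi.
have mn' : ((l + 1) * (tau m + 1) - 1 <= (l + 1) * (tau n + 1) - 1)%N.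
  by rewrite leq_sub2r// leq_mul2l leq_add2r mn orbT.
by rewrite geq_max !leq_max Sigma_mono ?Psi_mono ?orbT.
Qed.

Lemma sigma_mono k : {homo sigma gamma bA K sigma1 sigma2 k : m n / (m <= n)%N}.
Proof.
move=> m n mn; rewrite /sigma leq_sub2r//; apply: sigma2_mono.
by rewrite !leq_add2r; apply: le_ceiln_nat_div; rewrite leq_add2r.
Qed.

Lemma Kseq_ge m : (m <= Kseq K m)%N.
Proof.
rewrite /Kseq -[leqLHS]mul1n leq_mul ?muln_gt0 ?K_gt0//.
by rewrite addn1 expnS expn1 (leq_trans (leqnSn m))// leq_pmulr.
Qed.

Lemma Kseq_le_h k f m :
  (Kseq K m <= h gamma l bA K sigma1 sigma2 sigma3 tau k f m)%N.
Proof. by rewrite /h (leq_trans _ (leq_addr _ _))// leq_maxr. Qed.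

Lemma error_le_h k f m :
  (24 * K * (k0 k + 1)
     * (fmax f (sigma gamma bA K sigma1 sigma2 (k0 k)
         (phitilde gamma l bA K sigma1 sigma2 sigma3 tau (Kseq K m))) + 1)
   <= h gamma l bA K sigma1 sigma2 sigma3 tau k f m)%N.
Proof.
rewrite /h (leq_trans _ (leq_addr _ _))// leq_max; apply/orP; left.
by rewrite leq_max; apply/orP; left; rewrite /eta leq_max leq_maxl.
Qed.

(** The iterates increase because [h m >= Kseq m >= m]. *)
Lemma iter_h_mono k f : {homo (fun i =>
  iter i (h gamma l bA K sigma1 sigma2 sigma3 tau k f) 0%N) : i j / (i <= j)%N}.
Proof.
apply: homo_leq => [//|m n p|i]; first exact: leq_trans.
by rewrite iterS (leq_trans (Kseq_ge _))// Kseq_le_h.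
Qed.

(** Since [24 ^ 2 * 8 = 2 ^ 9 * 3 ^ 2], the right side is [3 / 2] times the rounded oscillation
    bound times [(ceiln (1 / gamma) * gamma) ^ 2], which is at least 1. *)
Lemma E_large k : (0 < bA)%N ->
  2^-1 * bA%:R * (K%:R + bp%:R) ^+ 2 + 2 * bU%:R * (K%:R + bp%:R)
  <= (E gamma bA bU bp K k)%:R
     * ((gamma / (6 * (4 * (k + 1) ^ 2))%:R) ^+ 2 / (8 * bA%:R * K%:R ^+ 2)).
Proof.
move=> bA0; rewrite -natrD -/(Ktilde bp K) /E; move: (Ktilde bp K) => Kt.
set X := 2^-1 * bA%:R * Kt%:R ^+ 2; set g := 1 / gamma.
rewrite -/X -/g.
have X0 : 0 <= X by rewrite !mulr_ge0 ?sqr_ge0.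
have g0 : 0 < g by rewrite divr_gt0.
have gE : g <= (ceiln g)%:R by rewrite ceiln_ge// ltW.
have XE : X <= (ceiln X)%:R by exact: ceiln_ge.
have bA1 : 0 < bA%:R :> R by rewrite ltr0n.
have K1 : 0 < K%:R :> R by rewrite ltr0n.
have k1 : 0 < (k + 1)%:R :> R by rewrite ltr0n addn1.
have gg : 1 <= ((ceiln g)%:R * gamma) ^+ 2.
  by rewrite exprn_ege1// -ler_pdivrMr.
move: (ceiln X) (ceiln g) XE gE gg => cX cg XE gE gg.
set L := X + _; pose L' : R := (cX + 2 * bU * Kt)%:R.
have LL : L <= L' by rewrite /L' natrD !natrM lerD2r.
have -> : (2 ^ 8 * 3 ^ 3 * bA * K ^ 2 * (cX + 2 * bU * Kt) * cg ^ 2 *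
     (k + 1) ^ 4)%:R = (2 ^+ 8 * 3 ^+ 3 * bA%:R * K%:R ^+ 2 * L' *
     cg%:R ^+ 2 * (k + 1)%:R ^+ 4) :> R.
  by rewrite /L' -!natrX -!natrM.
have -> : (6 * (4 * (k + 1) ^ 2))%:R = 24 * (k + 1)%:R ^+ 2 :> R.
  by rewrite mulnA natrM natrX.
set b := (k + 1)%:R in k1 *.
have -> : 2 ^+ 8 * 3 ^+ 3 * bA%:R * K%:R ^+ 2 * L' * cg%:R ^+ 2 * b ^+ 4 *
  ((gamma / (24 * b ^+ 2)) ^+ 2 / (8 * bA%:R * K%:R ^+ 2))
  = 3 / 2 * L' * (cg%:R * gamma) ^+ 2.
  move: k1 K1 bA1; rewrite /b; move: (k + 1)%:R bA%:R K%:R cg%:R => b' b2 b3 b4.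
  by move=> *; field; rewrite !gt_eqF.
have L0 : 0 <= L' by exact: ler0n.
have : L' * 1 <= L' * (cg%:R * gamma) ^+ 2 by rewrite ler_wpM2l.
lra.
Qed.

End Monotonicity.

(** * Assembly of the metastability bound *)

Theorem theorem2 (R : realType) (H : completeNormedModType R)
  (dot : {dot H for (@idfun R)}) (dot_norm : induces_norm dot)
  (A : {linear H -> H}) (gamma : R)
  (A_bounded : bounded_op A) (A_sa : self_adjoint dot A)
  (gamma_gt0 : 0 < gamma) (gamma_le1 : gamma <= 1)
  (A_pos : forall x : H, gamma * `|x| ^+ 2 <= dot (A x) x)
  (l : nat) (l_ge1 : (1 <= l)%N) (T : nat -> H -> H)
  (T_nonexp : forall i, (i < l)%N -> 1.-lipschitz (T i))
  (T_cyclic : forall n, (l <= n)%N -> T n = T (n %% l)%N)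
  (p : H) (pF : (\bigcap_(i < l) [set q | T i q = q]) p)
  (u : H) (alpha : nat -> R) (alpha01 : forall n, 0 < alpha n <= 1)
  (x : nat -> H)
  (x_rec : forall n, x n.+1 =
     (T n.+1 (x n) - alpha n.+1 *: A (T n.+1 (x n))) + alpha n.+1 *: u)
  (bA bU bp : nat) (bA_gt0 : (0 < bA)%N) (bU_gt0 : (0 < bU)%N)
  (bp_gt0 : (0 < bp)%N)
  (bA_ge : opnorm A <= bA%:R) (bU_ge : `|u| <= bU%:R) (bp_ge : `|p| <= bp%:R)
  (sigma1 sigma2 sigma3 : nat -> nat)
  (sigma1_mono : {homo sigma1 : m n / (m <= n)%N})
  (sigma2_mono : {homo sigma2 : m n / (m <= n)%N})
  (sigma3_mono : {homo sigma3 : m n / (m <= n)%N})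
  (C1q : forall k n, (sigma1 k <= n)%N -> alpha n <= 1 / (k + 1)%:R)
  (C2q : forall k, k%:R <= \sum_(0 <= n < (sigma2 k).+1) alpha n)
  (C3q : forall k n, (sigma3 k <= n)%N ->
     `|alpha n / alpha (n + l)%N - 1| <= 1 / (k + 1)%:R)
  (K : nat) (K_gt0 : (0 < K)%N)
  (K_ge : Num.max `|x (Qidx bA sigma1) - p| (`|u - A p| / gamma) <= K%:R)
  (tau : nat -> nat) (tau_mono : {homo tau : m n / (m <= n)%N})
  (tau_spec : forall (k m : nat) (y : H), closed_ball p K%:R y ->
     `|y - Ttilde T l m y| <= 1 / (tau k + 1)%:R ->
     forall i, (i < l)%N -> `|y - T i y| < 1 / (k + 1)%:R)
  (k : nat) (f : nat -> nat) :
  exists N : nat,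
    (N <= Omega gamma l bA bU bp K sigma1 sigma2 sigma3 tau k f)%N /\
    forall i j : nat, (N <= i <= fmax f N)%N -> (N <= j <= fmax f N)%N ->
      `|x i - x j| <= 1 / (k + 1)%:R.
Proof.
set h' := h gamma l bA K sigma1 sigma2 sigma3 tau k f.
have T_mod n : T n = T (n %% l)%N.
  by case: (ltnP n l) => [nl|/T_cyclic//]; rewrite modn_small.
have lmod n : (n %% l < l)%N by rewrite ltn_pmod.
have T_periodic n : T (n + l)%N = T n by rewrite T_mod modnDr -T_mod.
have T_fix n : T n p = p by rewrite T_mod; exact: (pF _ (lmod n)).
have T_ne n v w : `|T n v - T n w| <= `|v - w|.
  by rewrite T_mod -[leRHS]mul1r; exact: (T_nonexp _ (lmod n) (v, w)).
have A_ge0 y : 0 <= dot (A y) y.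
  by apply: le_trans (A_pos y); rewrite mulr_ge0 ?sqr_ge0// ltW.
move: K_ge; rewrite ge_max ler_pdivrMr// mulrC => /andP[xQ_le uAp_le].
have bA0 : 0 < bA%:R :> R by rewrite ltr0n.
have k0E : (k0 k + 1 = 4 * (k + 1) ^ 2)%N.
  by rewrite /k0 subnK// muln_gt0 expn_gt0 addn1.
(* The accuracy that [xu_near] asks for at [k0]; it gives squared distance [1 / (k0 + 1)], the
   square of [1 / (2 * (k + 1))]. *)
pose delta : R := gamma / (6 * (k0 k + 1))%:R.
have d0 : 0 < delta by rewrite divr_gt0// ltr0n muln_gt0 addn1.
have dle : delta <= 4 * bA%:R * K%:R ^+ 2.
  apply: (@le_trans _ _ 1).
    rewrite ler_pdivrMr ?ltr0n ?muln_gt0 ?addn1// mul1r (le_trans gamma_le1)//.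
    by rewrite ler1n muln_gt0.
  by rewrite -natrX -!natrM ler1n !muln_gt0 bA_gt0 K_gt0.
have := E_large bU bp gamma_gt0 K_gt0 k bA_gt0; rewrite -k0E -/delta => E_ge.
have T_ne' i v w (_ : (i < l)%N) := T_ne i v w.
have T_fix' i (_ : (i < l)%N) := T_fix i.
have h_ge m : (Kseq K m <= h' m)%N by exact: Kseq_le_h.
have [i [y [iE yK yT ymin]]] := quasi_minimizer dot_norm A_bounded A_sa bA_ge bA0
  A_ge0 T_ne' T_fix' K_gt0 bU_ge bp_ge d0 dle h_ge E_ge.
set m := iter i h' 0%N in yT ymin.
pose n := phitilde gamma l bA K sigma1 sigma2 sigma3 tau (Kseq K m).
pose N := sigma gamma bA K sigma1 sigma2 (k0 k) n.
have regular j : (n <= j)%N -> (Qidx bA sigma1 <= j)%N /\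
    `|x j - Ttilde T l j (x j)| <= 1 / (tau (Kseq K m) + 1)%:R.
  exact: (xu_Ttilde_regular dot_norm A_bounded A_sa gamma_gt0 gamma_le1 A_pos
    bA_gt0 bA_ge T_ne T_fix alpha01 x_rec C1q C2q K_gt0 xQ_le uAp_le sigma1_mono
    T_periodic C3q).
have xK j : (n <= j)%N -> `|x j - p| <= K%:R.
  move=> /regular[Qj _].
  exact: (xu_bounded dot_norm A_bounded A_sa gamma_gt0 gamma_le1 A_pos
    bA_gt0 bA_ge T_ne T_fix alpha01 x_rec C1q K_gt0 xQ_le uAp_le Qj).
have x_min j : (n <= j)%N -> dot (u - A y) (x j - y) <= delta.
  move=> nj; apply: ymin (xK _ nj) _ => t tl; apply: ltW.
  (* [tau] turns regularity under the cyclic product into closeness to every single map, so [x j] is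
     an admissible test point. *)
  apply: tau_spec (regular _ nj).2 _ tl.
  by rewrite closed_ballE ?ltr0n// /closed_ball_ /= distrC xK.
have yT' j : `|y - T j y| <= 1 / (24 * K * (k0 k + 1) * (fmax f N + 1))%:R.
  (* The [eta] term of [h] provides this precision: the defects of [y] accumulate over up to
     [fmax f N] steps. *)
  rewrite T_mod; apply: le_trans (yT _ (lmod j)) _.
  have D0 : (0 < 24 * K * (k0 k + 1) * (fmax f N + 1))%N.
    by rewrite !muln_gt0 K_gt0 !addn1.
  rewrite ler_pM2l// lef_pV2 ?posrE ?ltr0n//; last by rewrite addn1.
  by rewrite ler_nat; apply: leq_trans (leq_addr 1 _); exact: error_le_h.
have near j : (N <= j <= fmax f N)%N -> `|x j - y| <= 2^-1 * (1 / (k + 1)%:R).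
  move=> jN; rewrite -(@ler_pXn2r _ 2%N) ?nnegrE ?mulr_ge0 ?divr_ge0//.
  have [Qn _] := regular n (leqnn n).
  apply: le_trans (xu_near dot_norm A_bounded A_sa gamma_gt0 gamma_le1 A_pos
    bA_gt0 bA_ge T_ne T_fix alpha01 x_rec C1q C2q K_gt0
    xQ_le uAp_le yK Qn yT' x_min jN) _.
  rewrite k0E natrM natrX; have : 0 < (k + 1)%:R :> R by rewrite ltr0n addn1.
  move: ((k + 1)%:R : R) => b b0.
  suff -> : 1 / (4 * b ^+ 2) = (2^-1 * (1 / b)) ^+ 2 by [].
  by field; rewrite gt_eqF.
exists N; split.
  (* The index [i] is known only to be at most [E], so [m] is replaced by the [E]-th iterate and
     monotonicity of the rates does the rest. *)
  rewrite /Omega (leq_trans _ (leq_addr _ _))// /N; apply: sigma_mono => //.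
  apply: phitilde_mono => //; rewrite /Kseq leq_mul2l leq_sqr leq_add2r.
  by apply/orP; right; exact: iter_h_mono iE.
move=> i' j' i'N j'N; apply: le_trans (ler_distD y _ _) _.
have := near _ i'N; have := near _ j'N; rewrite [`|y - _|]distrC; lra.
Qed.
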